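(* Let $r$ be a nonnegative integer. For every integer $n\geq 0$, we have $$B^{(c,r)}_n(x)=\sum_{l=0}^n\sum_{m=0}^l x^m\binom{n}{l}S_2(l,m)\left(r-\frac{m}{2}\right)^{n-l}.$$
   Context: The Stirling numbers of the second kind $S_2(n,k)$ are defined by $x^n=\sum_{k=0}^n S_2(n,k)(x)_k$ for $n\ge 0$, where $(x)_0=1$ and $(x)_n=x(x-1)\cdots(x-n+1)$ for $n\ge1$; equivalently (well known), $\frac{1}{k!}(e^t-1)^k=\sum_{n=k}^\infty S_2(n,k)\frac{t^n}{n!}$ for $k\ge 0$. For a nonnegative integer $r$, the extended $r$-central Bell polynomials $B^{(c,r)}_n(x)$ are defined by the formal power series identity (in $t$) $$e^{rt}e^{x\left(e^{t/2}-e^{-t/2}\right)}=\sum_{n=0}^\infty B^{(c,r)}_n(x)\frac{t^n}{n!}.$$ Convention: $0^0=1$. *)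

(* Defs.v *)
From mathcomp Require Import all_boot all_order all_algebra.
From mathcomp Require Import ring.

Set Implicit Arguments.
Unset Strict Implicit.
Unset Printing Implicit Defensive.

Import GRing.Theory.
Local Open Scope ring_scope.

(* (x)_k = x (x - 1) ... (x - k + 1) *)
Definition falling (k : nat) : {poly rat} := \prod_(i < k) ('X - i%:R%:P).

Lemma falling_expansion (n : nat) :
  {c : nat -> rat | 'X^n = \sum_(k < n.+1) c k *: falling k}.
Proof.
elim: n => [|n [c Hc]].
  by exists (fun=> 1); rewrite big_ord1 /falling big_ord0 scale1r expr0.
exists (fun k => (if k is j.+1 then c j else 0)
                 + (if (k <= n)%N then k%:R * c k else 0)).
under eq_bigr => k _ do rewrite scalerDl.
rewrite big_split /= big_ord_recl scale0r add0r [X in _ + X]big_ord_recr /=.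
rewrite ltnn scale0r addr0 -big_split /= exprS Hc mulr_sumr.
apply: eq_bigr => -[k /= lekn] _; rewrite -ltnS lekn.
rewrite [falling k.+1]/falling big_ord_recr /= -/(falling k).
rewrite -!mul_polyC polyCM; ring.
Qed.

(* The Stirling numbers of the second kind: the coordinates of x^n in the basis
   of falling factorials, extended by 0 for k > n. *)
Definition stirling2 (n k : nat) : rat :=
  if (k <= n)%N then sval (falling_expansion n) k else 0.

Lemma stirling2E (n : nat) :
  'X^n = \sum_(k < n.+1) stirling2 n k *: falling k.
Proof.
rewrite {1}(svalP (falling_expansion n)); apply: eq_bigr => k _.
by rewrite /stirling2 -ltnS ltn_ord.
Qed.

Lemma size_falling (k : nat) : size (falling k) = k.+1.
Proof. by rewrite /falling size_prod_XsubC /index_enum -enumT size_enum_ord. Qed.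

Lemma falling_monic (k : nat) : falling k \is monic.
Proof. by apply: monic_prod => i _; apply: monicXsubC. Qed.

Lemma falling_free (n : nat) (c : nat -> rat) :
  \sum_(k < n) c k *: falling k = 0 -> forall k, (k < n)%N -> c k = 0.
Proof.
elim: n => // n IHn; rewrite big_ord_recr /= => H.
have cn0 : c n = 0.
  have := congr1 (fun p : {poly rat} => p`_n) H.
  rewrite coefD coef0 coefZ coef_sum big1 ?add0r => [|k _].
    have := monicP (falling_monic n); rewrite lead_coefE size_falling /= => ->.
    by rewrite mulr1.
  by rewrite coefZ nth_default ?mulr0 ?size_falling.
move=> k; rewrite ltnS leq_eqVlt => /predU1P[-> //|]; apply: IHn.
by move: H; rewrite cn0 scale0r addr0.
Qed.

Lemma stirling2_unique (n : nat) (c : nat -> rat) :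
  'X^n = \sum_(k < n.+1) c k *: falling k ->
  forall k, (k <= n)%N -> stirling2 n k = c k.
Proof.
move=> Hc k lekn; apply/eqP; rewrite -subr_eq0; apply/eqP.
apply: (@falling_free n.+1 (fun k => stirling2 n k - c k)) => //.
under eq_bigr => i _ do rewrite scalerBl.
by rewrite sumrB -stirling2E -Hc subrr.
Qed.

(* Formal power series in t over Q[x]: f i is the coefficient of t^i. *)
Definition fps := nat -> {poly rat}.

Definition fps_mul (f g : fps) : fps :=
  fun n => \sum_(i < n.+1) f i * g (n - i)%N.

Definition fps_one : fps := fun n => (n == 0)%:R.

Definition fps_pow (f : fps) (k : nat) : fps := iter k (fps_mul f) fps_one.

(* exp(f) = \sum_k f^k / k!, meaningful when f has zero constant term: then
   f^k has no t^n term for k > n, so the sum can be truncated (fps_expE). *)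
Definition fps_exp (f : fps) : fps :=
  fun n => \sum_(k < n.+1) (k`!%:R)^-1 *: fps_pow f k n.

Lemma fps_pow_small (f : fps) (k n : nat) :
  f 0%N = 0 -> (n < k)%N -> fps_pow f k n = 0.
Proof.
move=> f0; elim: k n => // k IHk n ltnk; rewrite /fps_pow iterS.
rewrite /fps_mul big1 // => -[[|i] /= lti] _; first by rewrite f0 mul0r.
rewrite [iter _ _ _ _]IHk ?mulr0 //.
apply: (@leq_trans n); last by rewrite -ltnS.
by rewrite ltn_subrL /=; apply: leq_ltn_trans (leq0n i) _.
Qed.

Lemma fps_expE (f : fps) (n N : nat) : f 0%N = 0 -> (n <= N)%N ->
  fps_exp f n = \sum_(k < N.+1) (k`!%:R)^-1 *: fps_pow f k n.
Proof.
move=> f0 lenN; rewrite /fps_exp.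
rewrite (big_ord_widen N.+1 (fun k => (k`!%:R)^-1 *: fps_pow f k n)) //.
rewrite big_mkcond; apply: eq_bigr => k _; case: ltnP => // ltnk.
by rewrite fps_pow_small ?scaler0.
Qed.

(* e^{c t} *)
Definition fps_exp_lin (c : rat) : fps :=
  fps_exp (fun n => if n == 1%N then c%:P else 0).

(* x (e^{t/2} - e^{-t/2}) *)
Definition central_series : fps :=
  fun n => 'X * (fps_exp_lin (1 / 2) n - fps_exp_lin (- (1 / 2)) n).

Lemma central_series0 : central_series 0 = 0.
Proof.
by rewrite /central_series /fps_exp_lin /fps_exp !big_ord1 subrr mulr0.
Qed.

(* B^{(c,r)}_n(x), as a polynomial in x = 'X: n! times the coefficient of t^n
   in e^{r t} e^{x (e^{t/2} - e^{-t/2})}. *)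
Definition central_bell (r n : nat) : {poly rat} :=
  n`!%:R *: fps_mul (fps_exp_lin r%:R) (fps_exp central_series) n.

(* Main.v *)
Require Import Defs.
From mathcomp Require Import all_boot all_order all_algebra.
From mathcomp Require Import ring.

Import GRing.Theory.
Local Open Scope ring_scope.

(** Write D for the forward difference operator on functions of y, and e_n for
    the function y^n / n!.  The coefficient of t^n in e^{at} (e^t - 1)^k is
    (D^k e_n)(a), so multiplying by e^{bt} translates a to a + b.  Hence
    (e^{t/2} - e^{-t/2})^k has coefficients (D^k e_n)(-k/2), and the coefficient
    of x^k in B_n is n!/k! (D^k e_n)(r - k/2).  Expanding around y = 0 with the
    same translation rule leaves (D^k y^l)(0), which is k! S_2(l,k) because
    D (y)_i = i (y)_{i-1}. *)

Definition fdiff (f : rat -> rat) : rat -> rat := fun y => f (y + 1) - f y.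

Lemma eq_iter_fdiff (k : nat) (f g : rat -> rat) :
  f =1 g -> iter k fdiff f =1 iter k fdiff g.
Proof. by move=> fg; elim: k => //= k IHk y; rewrite /fdiff !IHk. Qed.

Lemma iter_fdiff_sum (k n : nat) (c : nat -> rat) (f : nat -> rat -> rat) y :
  iter k fdiff (fun z => \sum_(i < n) c i * f i z) y =
  \sum_(i < n) c i * iter k fdiff (f i) y.
Proof.
elim: k y => //= k IHk y; rewrite {1}/fdiff !IHk -sumrB.
by apply: eq_bigr => i _; rewrite -mulrBr.
Qed.

Lemma iter_fdiff_shift (k : nat) (f : rat -> rat) (b y : rat) :
  iter k fdiff (fun z => f (z + b)) y = iter k fdiff f (y + b).
Proof. by elim: k y => //= k IHk y; rewrite /fdiff !IHk addrAC. Qed.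

Lemma falling0 : falling 0 = 1.
Proof. by rewrite /falling big_ord0. Qed.

Lemma horner_fallingS (k : nat) (y : rat) :
  (falling k.+1).[y] = (falling k).[y] * (y - k%:R).
Proof. by rewrite /falling big_ord_recr hornerM !hornerE. Qed.

(** Splitting off the first factor rather than the last exposes (y)_k, which is then common to both
    terms of the difference in [fdiff_falling]; what remains is (y + 1) - (y - k) = k + 1. *)
Lemma horner_fallingS_add1 (k : nat) (y : rat) :
  (falling k.+1).[y + 1] = (y + 1) * (falling k).[y].
Proof.
elim: k => [|k IHk]; first by rewrite horner_fallingS falling0 !hornerE; ring.
by rewrite horner_fallingS IHk horner_fallingS -natr1; ring.
Qed.

Lemma fdiff_falling (k : nat) (y : rat) :
  fdiff (fun z => (falling k).[z]) y = k%:R * (falling k.-1).[y].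
Proof.
case: k => [|k]; first by rewrite /fdiff falling0 !hornerE; ring.
by rewrite /fdiff horner_fallingS_add1 horner_fallingS /= -natr1; ring.
Qed.

(** Each difference lowers the index by one and brings out the current index as a factor. For k > i
    the factor [i ^_ k] is 0, so the truncated subtraction is harmless. *)
Lemma iter_fdiff_falling (k i : nat) (y : rat) :
  iter k fdiff (fun z => (falling i).[z]) y =
  (i ^_ k)%:R * (falling (i - k)).[y].
Proof.
elim: k y => [|k IHk] y; first by rewrite mul1r subn0.
rewrite iterS {1}/fdiff !IHk -mulrBr.
rewrite -[_ - _]/(fdiff (fun z => (falling (i - k)).[z]) y) fdiff_falling.
by rewrite mulrA -natrM -ffactnSr -subnS.
Qed.

Lemma iter_fdiff_falling0 (k i : nat) :
  iter k fdiff (fun z => (falling i).[z]) 0 = (i == k)%:R * k`!%:R.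
Proof.
rewrite iter_fdiff_falling; case: ltngtP => [ltik|ltki|->].
- by rewrite ffact_small // !mul0r.
(* For k < i the remaining falling factorial contains the factor y - 0, which vanishes at 0. *)
- rewrite -[(i - k)%N]prednK ?subn_gt0 // /falling big_ord_recl hornerM.
  by rewrite hornerXsubC subrr !mul0r mulr0.
by rewrite ffactnn subnn falling0 hornerE mulr1 mul1r.
Qed.

Lemma iter_fdiff_exp0 (k l : nat) :
  iter k fdiff (fun z => z ^+ l) 0 = k`!%:R * stirling2 l k.
Proof.
rewrite (eq_iter_fdiff k _
  (fun z => \sum_(i < l.+1) stirling2 l i * (falling i).[z])); last first.
  move=> z; rewrite -hornerXn stirling2E horner_sum.
  by apply: eq_bigr => i _; rewrite hornerZ.
rewrite (iter_fdiff_sum k l.+1 _ (fun i z => (falling i).[z])).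
under eq_bigr => i _ do rewrite iter_fdiff_falling0.
case: (leqP k l) => [lekl | ltlk].
  rewrite (bigD1 (inord k)) //= inordK ?ltnS // eqxx mul1r mulrC.
  rewrite big1 ?addr0 // => i neik.
  case: eqP => [eik | _]; last by rewrite mul0r mulr0.
  by move: neik; rewrite -eik inord_val eqxx.
(* For k > l no index i equals k, which agrees with the default value 0 of [stirling2]. *)
rewrite /stirling2 leqNgt ltlk mulr0 big1 // => i _.
case: eqP => [eik | _]; last by rewrite mul0r mulr0.
by have := ltn_ord i; rewrite eik ltnS leqNgt ltlk.
Qed.

Definition divpow (n : nat) (y : rat) : rat := y ^+ n / n`!%:R.

Lemma natr_neq0 (n : nat) : (0 < n)%N -> n%:R != 0 :> rat.
Proof. by move=> n_gt0; rewrite Num.Theory.pnatr_eq0 -lt0n. Qed.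

(** The binomial theorem divided by n!, in the convolution form of e^{(y+b)t} = e^{bt} e^{yt}. *)
Lemma divpowD (n : nat) (y b : rat) :
  divpow n (y + b) = \sum_(i < n.+1) divpow i b * divpow (n - i) y.
Proof.
rewrite /divpow exprDn mulr_suml; apply: eq_bigr => -[i /= lti] _.
rewrite -(bin_fact (m := i) (n := n)) // !natrM -mulr_natr.
have := natr_neq0 _ (fact_gt0 i).
have := natr_neq0 _ (fact_gt0 (n - i)).
have : 'C(n, i)%:R != 0 :> rat by rewrite natr_neq0 // bin_gt0.
by move=> *; field; apply/and3P.
Qed.

(** Differences are linear and commute with translation, so they pass through the convolution with
    the coefficients of e^{bt}. *)
Lemma iter_fdiff_divpowD (k n : nat) (y b : rat) :
  iter k fdiff (divpow n) (y + b) =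
  \sum_(i < n.+1) divpow i b * iter k fdiff (divpow (n - i)) y.
Proof.
rewrite -iter_fdiff_shift (eq_iter_fdiff k _ _ (fun z => divpowD n z b)).
exact: (iter_fdiff_sum k n.+1 (fun i => divpow i b)
          (fun i => divpow (n - i))).
Qed.

Lemma iter_fdiff_divpow (k n : nat) (b : rat) :
  n`!%:R * iter k fdiff (divpow n) b =
  k`!%:R * \sum_(l < n.+1) 'C(n, l)%:R * stirling2 l k * b ^+ (n - l).
Proof.
(* Reading b as 0 + b puts the differences at 0; reversing the sum makes l the exponent of the power
   being differenced. *)
rewrite -[b in LHS]add0r iter_fdiff_divpowD (reindex_inj rev_ord_inj) /=.
rewrite !mulr_sumr; apply: eq_bigr => -[l /= ltl] _.
rewrite subSS subKn //.
have -> : iter k fdiff (divpow l) 0 = l`!%:R^-1 * (k`!%:R * stirling2 l k).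
  rewrite -iter_fdiff_exp0.
  (* The scalar 1/l! comes out as a linear combination with a single term. *)
  have := iter_fdiff_sum k 1 (fun=> l`!%:R^-1) (fun=> (@GRing.exp rat)^~ l) 0.
  rewrite big_ord1 => <-; apply: eq_iter_fdiff => z.
  by rewrite big_ord1 /divpow mulrC.
rewrite -(bin_fact (m := l) (n := n)) // !natrM /divpow.
have := natr_neq0 _ (fact_gt0 l).
have := natr_neq0 _ (fact_gt0 (n - l)).
by move=> *; field; apply/andP.
Qed.

Lemma fps_pow_linear (c : rat) (k n : nat) :
  fps_pow (fun m => if m == 1%N then c%:P else 0) k n =
  if n == k then (c ^+ k)%:P else 0.
Proof.
elim: k n => [|k IHk] n; first by rewrite /fps_pow /= /fps_one; case: eqP.
rewrite /fps_pow iterS {1}/fps_mul.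
under eq_bigr => i _ do rewrite [iter _ _ _ _]IHk.
case: n => [|n]; first by rewrite big_ord1 mul0r.
rewrite 2!big_ord_recl mul0r add0r big1 ?addr0 => [|i _]; last by rewrite mul0r.
rewrite subSS subn0 eqSS /=.
by case: eqP => _; rewrite ?mulr0 // -polyCM -exprS.
Qed.

Lemma fps_exp_linE (c : rat) (n : nat) : fps_exp_lin c n = (divpow n c)%:P.
Proof.
rewrite /fps_exp_lin /fps_exp.
under eq_bigr => k _ do rewrite fps_pow_linear.
rewrite big_ord_recr /= eqxx big1 ?add0r => [|k _].
  by rewrite -mul_polyC -polyCM mulrC.
by rewrite gtn_eqF ?scaler0.
Qed.

(** By induction on k: e^{t/2} and e^{-t/2} translate the base point -k/2 to -(k+1)/2 + 1 and
    -(k+1)/2, and subtracting the two values is one more difference. *)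
Lemma fps_pow_central (k n : nat) :
  fps_pow central_series k n =
  iter k fdiff (divpow n) (- (k%:R / 2)) *: 'X^k.
Proof.
elim: k n => [|k IHk] n.
  rewrite /fps_pow /= /fps_one mul0r oppr0 /divpow expr0 alg_polyC expr0n.
  by case: n => [|n]; rewrite ?mul0r // divr1.
rewrite /fps_pow iterS {1}/fps_mul.
under eq_bigr => i _.
  rewrite [iter _ _ _ _]IHk /central_series !fps_exp_linE -polyCB.
  rewrite ['X * _]mulrC -mulrA mul_polyC -scalerAr -exprS scalerA.
  over.
rewrite -scaler_suml; congr (_ *: _).
rewrite iterS {2}/fdiff.
have -> : - (k.+1%:R / 2) + 1 = - (k%:R / 2) + 1 / 2 :> rat.
  by rewrite -natr1; field.
have -> : - (k.+1%:R / 2) = - (k%:R / 2) + (- (1 / 2)) :> rat.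
  by rewrite -natr1; field.
rewrite !iter_fdiff_divpowD -sumrB.
by apply: eq_bigr => i _; rewrite mulrBl.
Qed.

Theorem theorem2p8 (r n : nat) :
  central_bell r n =
  \sum_(l < n.+1) \sum_(m < l.+1)
    ('C(n, l)%:R * stirling2 l m * (r%:R - m%:R / 2) ^+ (n - l)) *: 'X^m.
Proof.
(* The range of m is extended to m <= n, where the added terms have [stirling2 l m] = 0, so that the
   sums can be exchanged. *)
transitivity (\sum_(m < n.+1) \sum_(l < n.+1)
    ('C(n, l)%:R * stirling2 l m * (r%:R - m%:R / 2) ^+ (n - l)) *: 'X^m
    : {poly rat}); last first.
  rewrite exchange_big /=; apply: eq_bigr => -[l /= ltl] _.
  rewrite [RHS](big_ord_widen n.+1 (fun m => ('C(n, l)%:R * stirling2 l m *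
    (r%:R - m%:R / 2) ^+ (n - l)) *: 'X^m : {poly rat})) //.
  rewrite [RHS]big_mkcond; apply: eq_bigr => m _; case: ltnP => // ltlm.
  by rewrite /stirling2 leqNgt ltlm mulr0 mul0r scale0r.
rewrite /central_bell /fps_mul.
under eq_bigr => i _.
  (* Truncating every coefficient of the exponential at the same bound n makes the range of m
     independent of i. *)
  rewrite (fps_expE central_series0 (leq_subr i n)) fps_exp_linE mulr_sumr.
  under eq_bigr => m _ do
    rewrite fps_pow_central mul_polyC !scalerA -mulrA mulrCA.
  over.
rewrite exchange_big scaler_sumr; apply: eq_bigr => m _ /=.
rewrite -!scaler_suml scalerA; congr (_ *: _).
(* The factor e^{rt} moves the base point from -m/2 to r - m/2. *)
rewrite -mulr_sumr -iter_fdiff_divpowD [- _ + _]addrC mulrCA.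
by rewrite iter_fdiff_divpow mulKf // natr_neq0 ?fact_gt0.
Qed.
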